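(* For every integer $q>0$, the Delta Potts interaction family $\mathfrak{I}^{q\text{-Potts}}$ is group--coset (with $S=[q]$ viewed as the group $\mathbb{Z}/q\mathbb{Z}$), globally satisfiable, functionally representable and contraction-closed.
   Context: The Delta Potts family $\mathfrak{I}^{q\text{-Potts}}=(S,\{\Phi^k\}_{k\ge0})$ has spin value set $S=[q]$, identified with $\mathbb{Z}/q\mathbb{Z}$ when a group structure is needed, and $\Phi^k(s_1,\dots,s_k)=1$ if $s_i=s_j$ for all $i,j\in[k]$, and $0$ otherwise. For an interaction family $(S,\{\Phi^k\}_{k\ge0})$ with $S$ finite and permutation-invariant $\Phi^k\colon S^k\to\{0,1\}$, put $K_{\Phi^k}=\{\boldsymbol{s}\in S^k\mid\Phi^k(\boldsymbol{s})=1\}$, and for $A\subseteq[k]$ let $\boldsymbol{s}|_A=(s_i)_{i\in A}$. Functionally representable: for every $k$ there is a partition $[k]=I\sqcup D$ and a map $\sigma\colon S^{|I|}\to S^{|D|}$ (dependency map) with $K_{\Phi^k}=\{(\boldsymbol{s}_I,\sigma(\boldsymbol{s}_I))\mid\boldsymbol{s}_I\in S^{|I|}\}$ ($\boldsymbol{s}_I$ placed on $I$, $\sigma(\boldsymbol{s}_I)$ on $D$). Contraction-closed (for a functionally representable family): for every $k$, every $k'\ge k$ and every partition $[k]=I\sqcup D$ with a map $\sigma\colon S^{|I|}\to S^{|D|}$ satisfying $K_{\Phi^k}=\{(\boldsymbol{s}_I,\sigma(\boldsymbol{s}_I))\mid\boldsymbol{s}_I\in S^{|I|}\}$ ($\boldsymbol{s}_I$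 placed on $I$, $\sigma(\boldsymbol{s}_I)$ on $D$), let $\hat\sigma\colon S^{[k']\setminus D}\to S^{[k']}$, $\hat\sigma(\boldsymbol{s})|_{[k']\setminus D}=\boldsymbol{s}$, $\hat\sigma(\boldsymbol{s})|_D=\sigma(\boldsymbol{s}|_I)$; then for every $A\subseteq[k']$ either $\Phi^{|A|}(\hat\sigma(\boldsymbol{s})|_A)$ is constant in $\boldsymbol{s}$, or there is a unique $A'\subseteq[k']\setminus D$ with $\Phi^{|A|}(\hat\sigma(\boldsymbol{s})|_A)=\Phi^{|A'|}(\boldsymbol{s}|_{A'})$ for all $\boldsymbol{s}\in S^{[k']\setminus D}$. Group--coset: $S$ is a finite group and, for all $k\ge0$, $K_{\Phi^k}$ is a coset of a subgroup of $S^k$. Globally satisfiable: there is $s\in S$ with $\Phi^k(s,\dots,s)=1$ for all $k$. *)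

(* Defs.v *)
From mathcomp Require Import all_boot all_order all_algebra all_fingroup.

Set Implicit Arguments.
Unset Strict Implicit.
Unset Printing Implicit Defensive.

(* S^T for a finite index type T is {ffun T -> S}; for an index subset
   A : {set T}, S^A is {ffun {x | x \in A} -> S}. *)

Section Configurations.
Variables (S : Type) (T : finType).
Implicit Type s : {ffun T -> S}.

Definition restrict (A : {set T}) s : {ffun {x | x \in A} -> S} :=
  [ffun x => s (val x)].

(* s|_A re-indexed by 'I_#|A| through the enumeration of A; for T = 'I_k this
   enumeration is increasing. *)
Definition select (A : {set T}) s : {ffun 'I_#|A| -> S} :=
  [ffun i => s (enum_val i)].

Lemma notin_setC (D : {set T}) x : x \notin D -> x \in ~: D.
Proof. by rewrite inE. Qed.

Definition glue (D : {set T}) (u : {ffun {x | x \in ~: D} -> S})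
    (v : {ffun {x | x \in D} -> S}) : {ffun T -> S} :=
  [ffun x => match boolP (x \in D) with
             | AltTrue xD => v (exist _ x xD)
             | AltFalse xnD => u (exist _ x (notin_setC xnD))
             end].

Lemma restrict_glueC D u v : restrict (~: D) (@glue D u v) = u.
Proof.
apply/ffunP => -[x xP]; rewrite !ffunE /=; case: {-}_ / boolP => [xD|xnD].
  by exfalso; move: xP; rewrite inE xD.
by congr (u _); apply: val_inj.
Qed.

Lemma restrict_glue D u v : restrict D (@glue D u v) = v.
Proof.
apply/ffunP => -[x xP]; rewrite !ffunE /=; case: {-}_ / boolP => [xD|xnD].
  by congr (v _); apply: val_inj.
by exfalso; move: xnD; rewrite xP.
Qed.

End Configurations.

Record interaction_family (S : finType) := InteractionFamily {
  Phi :> forall k : nat, {ffun 'I_k -> S} -> bool;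
  Phi_perm : forall k (p : {perm 'I_k}) (s : {ffun 'I_k -> S}),
    Phi [ffun i => s (p i)] = Phi s
}.

Section Properties.
Variables (S : finType) (F : interaction_family S).

Definition satisfying (k : nat) : {set {ffun 'I_k -> S}} :=
  [set s | Phi F s].

(* The partition [k] = I \sqcup D is given by D, with I = ~: D. *)
Definition dependency_map (k : nat) (D : {set 'I_k})
    (sigma : {ffun {i | i \in ~: D} -> S} -> {ffun {i | i \in D} -> S}) : Prop :=
  satisfying k = [set glue sI (sigma sI) | sI : {ffun {i | i \in ~: D} -> S}].

Definition functionally_representable : Prop :=
  forall k, exists (D : {set 'I_k})
    (sigma : {ffun {i | i \in ~: D} -> S} -> {ffun {i | i \in D} -> S}),
    dependency_map sigma.

Definition globally_satisfiable : Prop :=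
  exists s : S, forall k, Phi F [ffun _ : 'I_k => s].

Section Hat.
Variables (k k' : nat) (lekk' : k <= k') (D : {set 'I_k}).
Variable sigma : {ffun {i | i \in ~: D} -> S} -> {ffun {i | i \in D} -> S}.

(* D viewed as a subset of [k']. *)
Definition widen_set : {set 'I_k'} := [set widen_ord lekk' i | i in D].

Lemma mem_widen_set i : (widen_ord lekk' i \in widen_set) = (i \in D).
Proof. by apply: mem_imset => x y /(congr1 val) /= xy; apply: val_inj. Qed.

Lemma widen_setC (i : {i | i \in ~: D}) :
  widen_ord lekk' (val i) \in ~: widen_set.
Proof. by rewrite inE mem_widen_set -in_setC (valP i). Qed.

Lemma widen_set_ex (x : {x | x \in widen_set}) :
  exists i : {i | i \in D}, widen_ord lekk' (val i) == val x.
Proof. by case: x => x /= /imsetP[i iD ->]; exists (exist _ i iD). Qed.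

(* The inverse of the bijection D -> widen_set. *)
Definition unwiden (x : {x | x \in widen_set}) : {i | i \in D} :=
  xchoose (widen_set_ex x).

(* The map S^([k'] \ D) -> S^[k'] written \hat\sigma, for D a subset of
   [k] and hence of [k']. *)
Definition hat (s : {ffun {x | x \in ~: widen_set} -> S}) : {ffun 'I_k' -> S} :=
  let sI := [ffun i : {i | i \in ~: D} =>
               s (exist _ (widen_ord lekk' (val i)) (widen_setC i))] in
  glue s [ffun x => sigma sI (unwiden x)].

Lemma hat_out s : restrict (~: widen_set) (hat s) = s.
Proof. exact: restrict_glueC. Qed.

Lemma hat_in s :
  let t := [ffun i : 'I_k => hat s (widen_ord lekk' i)] in
  restrict D t = sigma (restrict (~: D) t).
Proof.
move=> t; apply/ffunP => i.
have iW : widen_ord lekk' (val i) \in widen_set by rewrite mem_widen_set (valP i).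
pose x : {x | x \in widen_set} := exist _ (widen_ord lekk' (val i)) iW.
have -> : restrict D t i = restrict widen_set (hat s) x by rewrite !ffunE.
rewrite restrict_glue ffunE.
have -> : unwiden x = i.
  apply: val_inj; apply: val_inj.
  exact: (congr1 val (eqP (xchooseP (widen_set_ex x)))).
congr (sigma _ i); apply/ffunP => j.
rewrite ffunE -[in LHS](hat_out s) ffunE.
by rewrite [RHS]ffunE [RHS]ffunE.
Qed.

End Hat.

Arguments hat {k k'} lekk' {D} sigma s.

(* Subsets A' of [k'] \ D are sets over the subtype {x | x \in ~: D}. The
   alternative is not exclusive. *)
Definition contraction_closed : Prop :=
  forall (k k' : nat) (lekk' : k <= k') (D : {set 'I_k})
    (sigma : {ffun {i | i \in ~: D} -> S} -> {ffun {i | i \in D} -> S}),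
  dependency_map sigma ->
  forall A : {set 'I_k'},
    (exists c : bool, forall s, Phi F (select A (hat lekk' sigma s)) = c)
    \/ (exists! A' : {set {x | x \in ~: widen_set lekk' D}},
          forall s, Phi F (select A (hat lekk' sigma s)) = Phi F (select A' s)).

End Properties.

(* {dffun _} carries the direct product group structure on S^k. *)
Definition group_coset (S : finGroupType) (F : interaction_family S) : Prop :=
  forall k, exists (H : {group {dffun 'I_k -> S}}) (a : {dffun 'I_k -> S}),
    satisfying F k = (a *: H)%g.

Definition potts_Phi (q k : nat) (s : {ffun 'I_k -> 'I_q}) : bool :=
  [forall i, forall j, s i == s j].

Lemma potts_Phi_perm q k (p : {perm 'I_k}) (s : {ffun 'I_k -> 'I_q}) :
  potts_Phi [ffun i => s (p i)] = potts_Phi s.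
Proof.
apply/'forall_forallP/'forall_forallP => eqs i j; last by rewrite !ffunE.
by have := eqs (p^-1 i)%g (p^-1 j)%g; rewrite !ffunE !permKV.
Qed.

Definition potts (q : nat) : interaction_family 'I_q :=
  InteractionFamily (@potts_Phi_perm q).

(* Main.v *)
Require Import Defs.
From mathcomp Require Import all_boot all_order all_algebra all_fingroup.

(** A tuple satisfies the Potts constraint exactly when all its entries agree,
    so [K] is the diagonal of [S^k].  The diagonal is a subgroup, it contains
    the tuple [(s, ..., s)] for every [s], and for [k > 0] it is the graph of the
    map that copies the first entry to all other places.  This gives the first three
    properties, with [H] the diagonal and [a = 1].

    Contraction-closedness is trivial when the spin set is a point, since then
    all tuples agree.  Suppose that there are at least two spins.  A dependency
    map on a nonempty [D] copies the entry at some fixed place outside [D]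
    ([dependency_map_free] provides the place), hence [hat sigma s] is
    [s \o r] for a map [r] from [k'] to the complement of [D] ([hat_potts]).
    Therefore the entries of [hat sigma s] agree on [A] if and only if those of
    [s] agree on [A' = r @: A].  If [A'] has at most one element, this always
    holds.  Otherwise [A'] can be recovered from the constraint that it
    defines: when [x] lies in [A'] but not in [B], the indicator of [x] is
    constant on [B] and not on [A'] ([select_potts_sub]). *)

Set Implicit Arguments.
Unset Strict Implicit.
Unset Printing Implicit Defensive.

Arguments hat {S k k'} lekk' {D} sigma s.
Arguments hat_out {S k k'} lekk' {D} sigma s.

(** * Glueing and dependency maps *)

Section Glue.
Variables (S : Type) (T : finType) (D : {set T}).
Variables (u : {ffun {x | x \in ~: D} -> S}) (v : {ffun {x | x \in D} -> S}).

Lemma glue_in x (xD : x \in D) : glue u v x = v (exist _ x xD).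
Proof. by rewrite -[in RHS](restrict_glue u v) [RHS]ffunE. Qed.

Lemma glue_out x (xD : x \in ~: D) : glue u v x = u (exist _ x xD).
Proof. by rewrite -[in RHS](restrict_glueC u v) [RHS]ffunE. Qed.

End Glue.

Lemma glue_restrict (S : Type) (T : finType) (D : {set T}) (s : {ffun T -> S}) :
  glue (restrict (~: D) s) (restrict D s) = s.
Proof.
apply/ffunP => x; have [xD|xD] := boolP (x \in D); first by rewrite glue_in ffunE.
by rewrite (glue_out _ _ (notin_setC xD)) ffunE.
Qed.

Section DependencyMap.
Variables (S : finType) (F : interaction_family S) (k : nat) (D : {set 'I_k}).
Variable sigma : {ffun {i | i \in ~: D} -> S} -> {ffun {i | i \in D} -> S}.
Hypothesis sigmaP : dependency_map F sigma.

Lemma dependency_map_inj s t :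
  Phi F s -> Phi F t -> restrict (~: D) s = restrict (~: D) t -> s = t.
Proof.
have glueE w : Phi F w ->
    w = glue (restrict (~: D) w) (sigma (restrict (~: D) w)).
  move=> Fw; have : w \in satisfying F k by rewrite inE.
  by rewrite sigmaP => /imsetP[u _ ->]; rewrite restrict_glueC.
by move=> /glueE sE /glueE tE st; rewrite sE tE st.
Qed.

Lemma hat_satisfying k' (lekk' : k <= k') s :
  Phi F [ffun i : 'I_k => hat lekk' sigma s (widen_ord lekk' i)].
Proof.
set t := [ffun _ => _]; suff : t \in satisfying F k by rewrite inE.
rewrite sigmaP; apply/imsetP; exists (restrict (~: D) t) => //.
by rewrite -hat_in glue_restrict.
Qed.

End DependencyMap.

(** * The Potts constraint *)

Section Potts.
Variable q : nat.

Lemma potts_PhiP k (s : {ffun 'I_k -> 'I_q}) :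
  reflect (forall i j, s i = s j) (potts_Phi s).
Proof.
by apply: (iffP 'forall_forallP) => eqs i j; apply/eqP; apply: eqs.
Qed.

Lemma select_pottsP (T : finType) (A : {set T}) (s : {ffun T -> 'I_q}) :
  reflect {in A &, forall x y, s x = s y} (potts_Phi (select A s)).
Proof.
apply: (iffP (potts_PhiP _)) => [eqs x y xA yA|eqs i j].
  by have := eqs (enum_rank_in xA x) (enum_rank_in xA y); rewrite !ffunE !enum_rankK_in.
by rewrite !ffunE; apply: eqs; apply: enum_valP.
Qed.

(** Contracting along [r] replaces the constraint on [A] by the one on the
    image of [A]; this produces the set [A'] of contraction-closedness. *)
Lemma select_potts_comp (T U : finType) (r : T -> U) (A : {set T})
    (s : {ffun U -> 'I_q}) (t : {ffun T -> 'I_q}) :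
  t =1 s \o r -> potts_Phi (select A t) = potts_Phi (select (r @: A) s).
Proof.
move=> tE; apply/select_pottsP/select_pottsP => eqs.
  by move=> _ _ /imsetP[x xA ->] /imsetP[y yA ->]; have := eqs x y xA yA; rewrite !tE.
by move=> x y xA yA; rewrite !tE; apply: eqs; apply: imset_f.
Qed.

Lemma select_potts_small (T : finType) (A : {set T}) (s : {ffun T -> 'I_q}) :
  #|A| <= 1 -> potts_Phi (select A s).
Proof. by move=> /card_le1_eqP A1; apply/select_pottsP => x y xA /(A1 x y xA) ->. Qed.

End Potts.

(** The spins 0 and 1 make the indicator of a point available. *)
Lemma select_potts_sub n (T : finType) (A B : {set T}) :
  1 < #|A| ->
  (forall s : {ffun T -> 'I_n.+2},
     potts_Phi (select B s) -> potts_Phi (select A s)) ->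
  A \subset B.
Proof.
move=> A_gt1 BA; apply/subsetP => x xA; apply/negPn/negP => xB.
pose s : {ffun T -> 'I_n.+2} := [ffun y => if y == x then ord_max else ord0].
have /BA/select_pottsP sA : potts_Phi (select B s).
  apply/select_pottsP => y z yB zB; rewrite !ffunE.
  by rewrite (negbTE (memPn xB y yB)) (negbTE (memPn xB z zB)).
have /card_gt0P[y] : 0 < #|A :\ x| by rewrite (cardsD1 x) xA in A_gt1.
by rewrite !inE => /andP[yx yA]; have := sA x y xA yA; rewrite !ffunE eqxx (negbTE yx).
Qed.

Lemma select_potts_inj n (T : finType) (A B : {set T}) :
  1 < #|A| ->
  (forall s : {ffun T -> 'I_n.+2},
     potts_Phi (select A s) = potts_Phi (select B s)) ->
  A = B.
Proof.
move=> A_gt1 AB.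
have sAB : A \subset B by apply: (select_potts_sub (n := n)) => // s; rewrite AB.
apply/eqP; rewrite eqEsubset sAB; apply: (select_potts_sub (n := n)).
  exact: leq_trans A_gt1 (subset_leq_card sAB).
by move=> s; rewrite AB.
Qed.

(** * The four properties *)

Lemma potts_globally_satisfiable n : globally_satisfiable (potts n.+1).
Proof. by exists ord0 => k; apply/potts_PhiP => i j; rewrite !ffunE. Qed.

Lemma potts_group_coset n : group_coset (potts n.+1).
Proof.
move=> k; pose H : {set {dffun 'I_k -> 'I_n.+1}} := satisfying (potts n.+1) k.
have gH : group_set H.
  apply/group_setP; split=> [|s t].
    by rewrite inE; apply/potts_PhiP => i j; rewrite !ffunE.
  rewrite !inE => /potts_PhiP es /potts_PhiP et; apply/potts_PhiP => i j.
  by rewrite !ffunE (es i j) (et i j).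
by exists (Group gH), 1%g; rewrite mul1g.
Qed.

Lemma potts_functionally_representable n :
  functionally_representable (potts n.+1).
Proof.
case=> [|k].
  (* S^0 has a single element, which satisfies the constraint. *)
  exists set0, (fun=> [ffun=> ord0]); apply/setP => s.
  rewrite inE; transitivity true; first by apply/potts_PhiP => -[].
  by apply/esym/imsetP; exists [ffun=> ord0] => //; apply/ffunP => -[].
have i0P : ord0 \in ~: [set~ ord0 : 'I_k.+1] by rewrite !inE eqxx.
exists [set~ ord0], (fun u => [ffun=> u (exist _ ord0 i0P)]).
apply/setP => s; rewrite inE; apply/potts_PhiP/imsetP => [eqs|[u _ ->]].
  exists (restrict (~: [set~ ord0]) s) => //.
  rewrite -[LHS](glue_restrict [set~ ord0]); congr glue.
  by apply/ffunP => i; rewrite !ffunE; apply: eqs.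
suff glueE i : glue u [ffun=> u (exist _ ord0 i0P)] i = u (exist _ ord0 i0P).
  by move=> i j; rewrite !glueE.
have [iD|iI] := boolP (i \in [set~ ord0]); first by rewrite glue_in ffunE.
rewrite (glue_out _ _ (notin_setC iI)); congr (u _); apply: val_inj => /=.
by move: iI; rewrite !inE negbK => /eqP.
Qed.

Section Contraction.
Variables (n k : nat) (D : {set 'I_k}).
Variable sigma :
  {ffun {i | i \in ~: D} -> 'I_n.+2} -> {ffun {i | i \in D} -> 'I_n.+2}.
Hypothesis sigmaP : dependency_map (potts n.+2) sigma.

(** If all places were dependent, a single tuple would satisfy the constraint,
    whereas the constant tuples 0 and 1 both do, and they differ since a
    nonempty [D] forces [k > 0]. *)
Lemma dependency_map_free : D != set0 -> exists i0, i0 \notin D.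
Proof.
case/set0Pn => i _; apply/existsP; rewrite -negb_forall.
apply/negP => /forallP DT.
have cstP (c : 'I_n.+2) : potts n.+2 k [ffun=> c].
  by apply/potts_PhiP => x y; rewrite !ffunE.
have : restrict (~: D) [ffun=> ord0 : 'I_n.+2] = restrict (~: D) [ffun=> ord_max].
  by apply/ffunP => -[j jD]; exfalso; move: (jD); rewrite inE DT.
move/(dependency_map_inj sigmaP (cstP _) (cstP _))/ffunP/(_ i).
by rewrite !ffunE.
Qed.

Lemma hat_potts k' (lekk' : k <= k') :
  exists r : 'I_k' -> {x | x \in ~: widen_set lekk' D},
    forall s, hat lekk' sigma s =1 s \o r.
Proof.
pose W := widen_set lekk' D.
have hatE s x (xW : x \in ~: W) : hat lekk' sigma s x = s (exist _ x xW).
  by rewrite -[in RHS](hat_out lekk' sigma s) [RHS]ffunE.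
have [D0|/dependency_map_free[i0 i0D]] := eqVneq D set0.
  have xW x : x \in ~: W by rewrite inE /W /widen_set D0 imset0 inE.
  by exists (fun x => exist _ x (xW x)) => s x /=; rewrite (hatE s x (xW x)).
have i0W : widen_ord lekk' i0 \in ~: W by rewrite inE mem_widen_set.
pose x0 : {x | x \in ~: W} := Sub (widen_ord lekk' i0) i0W.
exists (insubd x0) => s x /=.
have [xW|xW] := boolP (x \in ~: W).
  by rewrite (hatE s x xW); congr (s _); apply: val_inj; rewrite val_insubd xW.
(* The first k entries of hat sigma s agree, hence a dependent one equals the
   one at i0. *)
have -> : insubd x0 x = x0 by apply: val_inj; rewrite val_insubd (negbTE xW).
move: xW; rewrite inE negbK => /imsetP[i _ ->]; rewrite /x0 -hatE.
by have /potts_PhiP/(_ i i0) := hat_satisfying sigmaP s; rewrite !ffunE.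
Qed.

End Contraction.

Lemma potts_contraction_closed n : contraction_closed (potts n.+1).
Proof.
case: n => [|n] k k' lekk' D sigma sigmaP A.
  by left; exists true => s; apply/potts_PhiP => i j; rewrite !ord1.
have [r rP] := hat_potts sigmaP lekk'.
have selE s : potts_Phi (select A (hat lekk' sigma s))
    = potts_Phi (select (r @: A) s) by apply: select_potts_comp.
have [rA_le1|rA_gt1] := leqP #|r @: A| 1; [left|right].
  by exists true => s; rewrite /= selE select_potts_small.
exists (r @: A); split=> // B BP; apply: (select_potts_inj (n := n)) => // s.
by rewrite -selE; apply: BP.
Qed.

(* The integer q > 0 is n.+1, for which 'I_n.+1 carries the library's group
   structure of addition modulo n.+1. *)
Theorem proposition5p17 (n : nat) :
  [/\ group_coset (potts n.+1),
      globally_satisfiable (potts n.+1),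
      functionally_representable (potts n.+1)
    & contraction_closed (potts n.+1)].
Proof.
split.
- exact: potts_group_coset.
- exact: potts_globally_satisfiable.
- exact: potts_functionally_representable.
- exact: potts_contraction_closed.
Qed.
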